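(* Let $X$ be a measure space with a $\sigma$-finite Borel measure $\mu$, and let $1\leq p<\infty$. Then $S_p(X)=\{0\}$ if and only if $\mu$ is without atom.
   Context: All spaces are over $\mathbb{C}$. For a Hilbert space $\mathcal{H}$ and $1\leq p<\infty$, $S_p(\mathcal{H})$ denotes the $p$-th Schatten class, i.e. the set of bounded (compact) operators $T$ on $\mathcal{H}$ with $\|T\|_p=\big(\sum_{n\geq 1}s_n(T)^p\big)^{1/p}<\infty$, where $s_1(T)\geq s_2(T)\geq\dots\geq 0$ are the singular values of $T$. Let $\pi:L^\infty(X)\to B(L^2(X))$ be the faithful representation by multiplication, $\pi(f)g=f\cdot g$ for $f\in L^\infty(X)$, $g\in L^2(X)$. Define $S_p(X)=\pi^{-1}\big(S_p(L^2(X))\big)=\{f\in L^\infty(X): \pi(f)\in S_p(L^2(X))\}$, which is an ideal in $L^\infty(X)$. A measurable set $A\subset X$ is an atom of $\mu$ if $\mu(A)>0$ and for every measurable $B\subset A$ either $\mu(B)=0$ or $\mu(B)=\mu(A)$. The measure $\mu$ is said to be without atom if it has no atoms. *)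

(* Defs.v *)
From HB Require Import structures.
From mathcomp Require Import all_boot all_order all_algebra.
From mathcomp Require Import sesquilinear generic_quotient ring_quotient.
From mathcomp Require Import all_classical all_reals all_analysis.
From mathcomp Require Import measurable_realfun ess_sup_inf.
From mathcomp.real_closed Require Import complex.

Set Implicit Arguments.
Unset Strict Implicit.
Unset Printing Implicit Defensive.

Import Order.TTheory GRing.Theory Num.Theory.
Import numFieldNormedType.Exports.
Local Open Scope classical_set_scope.
Local Open Scope ring_scope.

Notation cabs := Normc.normc.

Section complex_measurable.
Context d (T : measurableType d) (R : realType).
Implicit Types f g : T -> R[i].

(* Equivalent to Borel measurability for the usual topology of R[i] = R x R. *)
Definition cmeasurable f :=
  measurable_fun setT (fun x => complex.Re (f x)) /\
  measurable_fun setT (fun x => complex.Im (f x)).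

Lemma cabsD (x y : R[i]) : cabs (x + y) <= cabs x + cabs y.
Proof. exact: (@le_normcD R x y). Qed.

Lemma cabs_ge0 (x : R[i]) : 0 <= cabs x.
Proof. by case: x => a b; rewrite /= sqrtr_ge0. Qed.

Lemma cabs_norm (x : R[i]) : `|x| = (cabs x)%:C%C.
Proof. by rewrite normc_def; case: x. Qed.

Lemma cmeasurable_cst (a : R[i]) : cmeasurable (fun=> a).
Proof. by split; exact: measurable_cst. Qed.

Lemma cmeasurableD f g : cmeasurable f -> cmeasurable g ->
  cmeasurable (fun x => f x + g x).
Proof.
move=> [f1 f2] [g1 g2]; split.
  rewrite (_ : (fun x => _) =
    (fun x => complex.Re (f x)) \+ (fun x => complex.Re (g x))).
    exact: measurable_funD.
  by apply/funext => x /=; case: (f x); case: (g x).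
rewrite (_ : (fun x => _) =
    (fun x => complex.Im (f x)) \+ (fun x => complex.Im (g x))).
  exact: measurable_funD.
by apply/funext => x /=; case: (f x); case: (g x).
Qed.

Lemma cmeasurableM f g : cmeasurable f -> cmeasurable g ->
  cmeasurable (fun x => f x * g x).
Proof.
move=> [f1 f2] [g1 g2]; split.
  rewrite (_ : (fun x => _) =
    (fun x => complex.Re (f x) * complex.Re (g x)) \-
    (fun x => complex.Im (f x) * complex.Im (g x))).
    by apply: measurable_funB; exact: measurable_funM.
  by apply/funext => x /=; case: (f x); case: (g x).
rewrite (_ : (fun x => _) =
    (fun x => complex.Re (f x) * complex.Im (g x)) \+
    (fun x => complex.Im (f x) * complex.Re (g x))).
  by apply: measurable_funD; exact: measurable_funM.
by apply/funext => x /=; case: (f x); case: (g x).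
Qed.

Lemma cmeasurable_conj f : cmeasurable f -> cmeasurable (fun x => (f x)^*%C).
Proof.
move=> [f1 f2]; split.
  rewrite (_ : (fun x => _) = fun x => complex.Re (f x))//.
  by apply/funext => x; case: (f x).
rewrite (_ : (fun x => _) = \- (fun x => complex.Im (f x))).
  exact: measurableT_comp.
by apply/funext => x /=; case: (f x).
Qed.

Lemma measurable_cabs f : cmeasurable f ->
  measurable_fun setT (fun x => cabs (f x)).
Proof.
move=> [f1 f2].
rewrite (_ : (fun x => _) =
  Num.sqrt \o (fun x => complex.Re (f x) ^+ 2 + complex.Im (f x) ^+ 2)).
  apply: (@measurableT_comp _ _ _ _ _ _ (@Num.sqrt R)).
    by apply: continuous_measurable_fun; exact: sqrt_continuous.
  by apply: measurable_funD; exact: measurable_funX.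
by apply/funext => x /=; case: (f x).
Qed.

End complex_measurable.

Section Lnorm_monotone.
Context d (T : measurableType d) (R : realType).
Variable mu : {measure set T -> \bar R}.

Lemma le_Lnorm_ae (p : \bar R) (f g : T -> R) : (1 <= p)%E ->
  measurable_fun setT f -> measurable_fun setT g ->
  (forall x, 0 <= f x) -> (forall x, 0 <= g x) ->
  (\forall x \ae mu, f x <= g x) ->
  ('N[mu]_p[EFin \o f] <= 'N[mu]_p[EFin \o g])%E.
Proof.
move=> p1 mf mg f0 g0 fg; rewrite unlock /Lnorm; case: p p1 => [r|_|//].
  rewrite lee_fin => r1.
  have r0 : 0 < r by rewrite (lt_le_trans ltr01).
  have mp (h : T -> R) : measurable_fun setT h ->
      measurable_fun setT (fun x => `|(EFin \o h) x| `^ r)%E.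
    move=> mh; apply: (@measurableT_comp _ _ _ _ _ _ (fun x => x `^ r)%E) => //=.
      exact: (measurableT_comp (measurable_poweR _)).
    apply: measurableT_comp => //; exact: measurableT_comp.
  apply: gt0_ler_poweR; first by rewrite invr_ge0 ltW.
  - by rewrite in_itv/= leey andbT integral_ge0// => x _; exact: poweR_ge0.
  - by rewrite in_itv/= leey andbT integral_ge0// => x _; exact: poweR_ge0.
  apply: ae_ge0_le_integral => //; [by move=> x _; exact: poweR_ge0|exact: mp| |exact: mp|].
    by move=> x _; exact: poweR_ge0.
  apply: filterS fg => x fgx _.
  rewrite gt0_ler_poweR ?in_itv/= ?leey ?andbT ?lee_fin ?normr_ge0 ?(ltW r0)//.
  by rewrite !ger0_norm.
case: ifPn => // _; apply: le_ess_sup.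
by apply: filterS fg => x fgx /=; rewrite lee_fin !ger0_norm.
Qed.

Lemma eq_Lnorm_ae (p : \bar R) (f g : T -> R) : (1 <= p)%E ->
  measurable_fun setT f -> measurable_fun setT g ->
  (forall x, 0 <= f x) -> (forall x, 0 <= g x) ->
  (\forall x \ae mu, f x = g x) ->
  ('N[mu]_p[EFin \o f] = 'N[mu]_p[EFin \o g])%E.
Proof.
move=> p1 mf mg f0 g0 fg; apply/eqP; rewrite eq_le !le_Lnorm_ae//;
  by apply: filterS fg => x ->.
Qed.

Lemma LnormZ_ge0 (p : \bar R) (f : T -> R) (a : R) : (1 <= p)%E ->
  measurable_fun setT f -> ('N[mu]_p[EFin \o f] < +oo)%E ->
  ('N[mu]_p[EFin \o (fun x => a * f x)%R] = `|a|%:E * 'N[mu]_p[EFin \o f])%E.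
Proof.
move=> p1 mf nf.
have fP : f \in Lfun mu p by rewrite inE; apply/andP; split; rewrite inE.
exact: (LnormZ (Lfun_Sub p1 fP) a).
Qed.

End Lnorm_monotone.

Section Lp_functions.
Context d (T : measurableType d) (R : realType).
Variables (mu : {measure set T -> \bar R}) (p : \bar R) (p1 : (1 <= p)%E).

Definition cLnorm (f : T -> R[i]) : \bar R :=
  'N[mu]_p[EFin \o (fun x => cabs (f x))]%E.

(* The proof of 1 <= p is a dummy argument: it lets the closure of this set
   under linear combinations be registered as an instance. *)
Definition cLfun of (1 <= p)%E : {pred T -> R[i]} :=
  mem [set f | cmeasurable f /\ (cLnorm f < +oo)%E].

Lemma cLfunP (f : T -> R[i]) :
  f \in cLfun p1 <-> cmeasurable f /\ (cLnorm f < +oo)%E.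
Proof. by rewrite inE. Qed.

Lemma cLnormD_le (f g : T -> R[i]) : cmeasurable f -> cmeasurable g ->
  (cLnorm (fun x => f x + g x)%R <= cLnorm f + cLnorm g)%E.
Proof.
move=> mf mg.
have mcf := measurable_cabs mf; have mcg := measurable_cabs mg.
apply: le_trans (eminkowski mu mcf mcg p1).
apply: le_Lnorm_ae => //.
- exact/measurable_cabs/cmeasurableD.
- exact: measurable_funD.
- by move=> x; exact: cabs_ge0.
- by move=> x; rewrite addr_ge0// cabs_ge0.
- by apply/nearW => x; exact: cabsD.
Qed.

Lemma cLnormZE (a : R[i]) (f : T -> R[i]) : cmeasurable f -> (cLnorm f < +oo)%E ->
  (cLnorm (fun x => a * f x)%R = (cabs a)%:E * cLnorm f)%E.
Proof.
move=> mf nf; rewrite -[in RHS](ger0_norm (cabs_ge0 a)).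
rewrite -LnormZ_ge0//; last exact: measurable_cabs.
by apply: eq_Lnorm => x /=; rewrite Normc.normcM.
Qed.

Lemma cLfun_submod_closed : submod_closed (cLfun p1).
Proof.
split.
  apply/cLfunP; split; first exact: cmeasurable_cst.
  rewrite /cLnorm (_ : _ \o _ = cst 0%E); last first.
    by apply/funext => x /=; rewrite expr0n/= addr0 sqrtr0.
  by rewrite Lnorm0// gt_eqF// (lt_le_trans _ p1).
move=> a f g /cLfunP[mf nf] /cLfunP[mg ng]; apply/cLfunP.
have maf : cmeasurable (fun x => a * f x).
  exact: cmeasurableM (cmeasurable_cst _ _) mf.
split; first exact: cmeasurableD.
apply: le_lt_trans (cLnormD_le maf mg) _.
by rewrite lte_add_pinfty// cLnormZE// lte_mul_pinfty// lee_fin cabs_ge0.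
Qed.

HB.instance Definition _ :=
  GRing.isSubmodClosed.Build _ _ (cLfun p1) cLfun_submod_closed.

Record cLfunType := CLfun {
  cLfun_fun :> T -> R[i] ;
  cLfun_mem : cLfun_fun \in cLfun p1 }.

HB.instance Definition _ := [isSub for cLfun_fun].
HB.instance Definition _ := [Choice of cLfunType by <:].
HB.instance Definition _ := [SubChoice_isSubLmodule of cLfunType by <:].

Lemma cLfunDE (f g : cLfunType) x : (f + g) x = f x + g x. Proof. by []. Qed.

Lemma cLfunBE (f g : cLfunType) x : (f - g) x = f x - g x. Proof. by []. Qed.

Lemma cLfunZE (a : R[i]) (f : cLfunType) x : (a *: f) x = a * f x.
Proof. by []. Qed.

Definition null_fun : {pred cLfunType} :=
  mem [set f : cLfunType | \forall x \ae mu, f x = 0].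

Lemma null_funP (f : cLfunType) : f \in null_fun <-> \forall x \ae mu, f x = 0.
Proof. by rewrite inE. Qed.

Lemma null_fun_submod_closed : submod_closed null_fun.
Proof.
split; first by apply/null_funP/nearW.
move=> a f g /null_funP f0 /null_funP g0; apply/null_funP.
by apply: filterS2 f0 g0 => x fx gx; rewrite cLfunDE cLfunZE fx gx mulr0 addr0.
Qed.

HB.instance Definition _ :=
  GRing.isSubmodClosed.Build _ _ null_fun null_fun_submod_closed.

(* Complex L^p(mu), 1 <= p <= +oo: classes of functions modulo equality almost
   everywhere; for p = +oo, Lnorm is the essential supremum of the modulus. *)
Definition cLp := Quotient.quot null_fun.

HB.instance Definition _ := GRing.Zmodule.on cLp.
HB.instance Definition _ := EqQuotient.on cLp.

Local Open Scope quotient_scope.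

Lemma eq_cLp (f g : cLfunType) :
  \pi_cLp f = \pi_cLp g <-> \forall x \ae mu, f x = g x.
Proof.
split.
  move=> /eqP; rewrite -Quotient.idealrBE => /null_funP.
  by apply: filterS => x; rewrite cLfunBE => /eqP; rewrite subr_eq0 => /eqP.
move=> fg; apply/eqP; rewrite -Quotient.idealrBE; apply/null_funP.
by apply: filterS fg => x fgx; rewrite cLfunBE fgx subrr.
Qed.

Lemma repr_cLp (f : cLfunType) : \forall x \ae mu, repr (\pi_cLp f) x = f x.
Proof. by apply/eq_cLp; rewrite reprK. Qed.

Definition cLp_scale (a : R[i]) (u : cLp) : cLp := \pi_cLp (a *: repr u).

Lemma pi_cLpD (f g : cLfunType) : \pi_cLp (f + g) = \pi_cLp f + \pi_cLp g.
Proof. exact (Quotient.pi_add null_fun f g). Qed.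

Lemma pi_cLp0 : \pi_cLp (0 : cLfunType) = 0.
Proof. by apply: (@addrI _ (\pi_cLp 0)); rewrite -pi_cLpD !addr0. Qed.

Lemma pi_cLpZ (a : R[i]) (f : cLfunType) : \pi_cLp (a *: f) = cLp_scale a (\pi_cLp f).
Proof.
by apply/eq_cLp; apply: filterS (repr_cLp f) => x fx; rewrite !cLfunZE fx.
Qed.

Lemma cLp_scaleA (a b : R[i]) (u : cLp) : cLp_scale a (cLp_scale b u) = cLp_scale (a * b) u.
Proof.
rewrite -[u]reprK; move: (repr u) => f.
by rewrite -(pi_cLpZ b f) -(pi_cLpZ a (b *: f)) -(pi_cLpZ (a * b) f) scalerA.
Qed.

Lemma cLp_scale1 : left_id 1 cLp_scale.
Proof.
by move=> u; rewrite -[u]reprK; move: (repr u) => f; rewrite -pi_cLpZ scale1r.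
Qed.

Lemma cLp_scaleDr : right_distributive cLp_scale +%R.
Proof.
move=> a u v; rewrite -[u]reprK -[v]reprK; move: (repr u) (repr v) => f g.
by rewrite -pi_cLpD -(pi_cLpZ a f) -(pi_cLpZ a g) -(pi_cLpZ a (f + g)) -pi_cLpD scalerDr.
Qed.

Lemma cLp_scaleDl (u : cLp) : {morph cLp_scale^~ u : a b / a + b}.
Proof.
move=> a b; rewrite -[u]reprK; move: (repr u) => f.
by rewrite -(pi_cLpZ a f) -(pi_cLpZ b f) -(pi_cLpZ (a + b) f) -pi_cLpD scalerDl.
Qed.

HB.instance Definition _ := GRing.Zmodule_isLmodule.Build R[i] cLp
  cLp_scaleA cLp_scale1 cLp_scaleDr cLp_scaleDl.

Lemma cLnorm_ae (f g : cLfunType) :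
  (\forall x \ae mu, f x = g x) -> cLnorm f = cLnorm g.
Proof.
move=> fg; have /cLfunP[mf _] := cLfun_mem f.
have /cLfunP[mg _] := cLfun_mem g.
apply: eq_Lnorm_ae => //; [exact: measurable_cabs|exact: measurable_cabs| | |].
- by move=> x; exact: cabs_ge0.
- by move=> x; exact: cabs_ge0.
- by apply: filterS fg => x ->.
Qed.

Definition cLp_norm (u : cLp) : R[i] := (fine (cLnorm (repr u)))%:C%C.

Lemma cLp_norm_pi (f : cLfunType) : cLp_norm (\pi_cLp f) = (fine (cLnorm f))%:C%C.
Proof. by rewrite /cLp_norm (cLnorm_ae (repr_cLp f)). Qed.

Lemma cLnorm_fin_num (f : cLfunType) : cLnorm f \is a fin_num.
Proof.
by have /cLfunP[_ nf] := cLfun_mem f; rewrite ge0_fin_numE// Lnorm_ge0.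
Qed.

Lemma ler_cLp_normD (u v : cLp) : cLp_norm (u + v) <= cLp_norm u + cLp_norm v.
Proof.
rewrite -[u]reprK -[v]reprK; move: (repr u) (repr v) => f g.
rewrite -pi_cLpD !cLp_norm_pi -rmorphD/= lecR.
rewrite -lee_fin EFinD (fineK (cLnorm_fin_num f)) (fineK (cLnorm_fin_num g)).
rewrite (fineK (cLnorm_fin_num (f + g))).
have /cLfunP[mf _] := cLfun_mem f; have /cLfunP[mg _] := cLfun_mem g.
exact: cLnormD_le.
Qed.

Lemma cLp_normZ (a : R[i]) (u : cLp) : cLp_norm (a *: u) = `|a| * cLp_norm u.
Proof.
rewrite -[u]reprK; move: (repr u) => f; rewrite -[_ *: _]pi_cLpZ !cLp_norm_pi cabs_norm -rmorphM/=; congr _%:C%C.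
apply: EFin_inj; rewrite EFinM (fineK (cLnorm_fin_num f)).
rewrite (fineK (cLnorm_fin_num (a *: f))).
have /cLfunP[mf nf] := cLfun_mem f.
exact: cLnormZE.
Qed.

Lemma cLp_norm0_eq0 (u : cLp) : cLp_norm u = 0 -> u = 0.
Proof.
rewrite -[u]reprK; move: (repr u) => f; rewrite cLp_norm_pi => /complexI nu0.
have /cLfunP[mf _] := cLfun_mem f.
have : cLnorm f = 0%E by rewrite -(fineK (cLnorm_fin_num f)) nu0.
move=> /Lnorm_eq0_eq0 h.
rewrite -pi_cLp0; apply/eq_cLp.
have := h _ (lt_le_trans lte01 p1).
move=> /(_ ltac:(apply/measurable_EFinP; exact: measurable_cabs mf)) fu0.
apply: filterS fu0 => x /= /(_ I) [fx0].
exact: Normc.eq0_normc.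
Qed.

HB.instance Definition _ := Lmodule_isNormed.Build R[i] cLp
  ler_cLp_normD cLp_normZ cLp_norm0_eq0.

End Lp_functions.

(* Complex inner products are linear in the first variable and induce the norm.
   Completeness is not part of the structure: none of the notions below needs
   it to be defined, and they are only used on L^2. *)
HB.mixin Record isInnerProduct (R : realType) H & NormedModule R[i] H := {
  inner : {dot H for @conjc R} ;
  inner_norm : forall x : H, `|x| ^+ 2 = inner x x }.

#[short(type="innerProductType")]
HB.structure Definition InnerProduct (R : realType) :=
  {H of isInnerProduct R H & NormedModule R[i] H}.

Section Schatten_class.
Context (R : realType) (H : innerProductType R).
Implicit Types T S : {linear H -> H}.

Definition bounded_operator T :=
  exists M : R, forall x, `|T x| <= M%:C%C * `|x|.

Definition compact_operator T := precompact (T @` [set x | `|x| <= 1]).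

Definition adjoint_of T S := forall x y, inner (T x) y = inner x (S y).

Definition eigenspace (T : H -> H) (a : R[i]) : set H := [set x | T x = a *: x].

(* For a subspace V (so that 0 is in V): e is a basis of V. *)
Definition has_dim (V : set H) (k : nat) := exists e : 'I_k -> H,
  forall x, V x <-> exists! c : {ffun 'I_k -> R[i]}, x = \sum_i c i *: e i.

(* s lists the eigenvalues of |T| = (T^* T)^(1/2), i.e. the square roots of the
   eigenvalues of T^* T, in nonincreasing order and repeated according to
   multiplicity: each t > 0 occurs in s as many times as the dimension of
   ker (T^* T - t^2). When T is compact this determines s; s is padded with
   zeros when T has finite rank. The indexing starts at 0. *)
Definition singular_values T (s : nat -> R) :=
  [/\ nonincreasing_seq s, (forall n, 0 <= s n) &
   exists2 S, adjoint_of T S & forall t, 0 < t -> exists2 k,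
     has_dim (eigenspace (S \o T) (t ^+ 2)%:C%C) k & ([set n | s n = t] #= `I_k)%card].

(* The Schatten norm of T is the l^p norm of its singular values, i.e. their
   L^p norm for the counting measure on nat. *)
Definition schatten_class (p : R) : set {linear H -> H} :=
  [set T | [/\ bounded_operator T, compact_operator T &
    exists2 s, singular_values T s & ('N[counting]_p%:E[EFin \o s] < +oo)%E]].

End Schatten_class.

Section complex_integral.
Context d (T : measurableType d) (R : realType).
Variable mu : {measure set T -> \bar R}.
Implicit Types h k : T -> R[i].

Definition cintegral h : R[i] :=
  Complex (\int[mu]_x complex.Re (h x)) (\int[mu]_x complex.Im (h x)).

Definition cintegrable h :=
  mu.-integrable setT (EFin \o (fun x => complex.Re (h x))) /\
  mu.-integrable setT (EFin \o (fun x => complex.Im (h x))).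

Lemma cintegralD h k : cintegrable h -> cintegrable k ->
  cintegral (fun x => h x + k x) = cintegral h + cintegral k.
Proof.
move=> [h1 h2] [k1 k2].
rewrite /cintegral [RHS]/GRing.add/= -!RintegralD//; congr Complex;
  by apply: eq_Rintegral => x _; case: (h x); case: (k x).
Qed.

Lemma cintegralZ (a : R[i]) h : cintegrable h ->
  cintegral (fun x => a * h x) = a * cintegral h.
Proof.
case: a => a b [h1 h2].
have e1 c (g : T -> R) : mu.-integrable setT (EFin \o g) ->
    mu.-integrable setT (EFin \o (fun x => c * g x)).
  by move=> ig; exact: (integrableZl measurableT c ig).
rewrite /cintegral [RHS]/GRing.mul/= -!RintegralZl// -?RintegralB -?RintegralD//;
  try exact: e1.
by congr Complex; apply: eq_Rintegral => x _; case: (h x).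
Qed.

Lemma cintegral_conj h : cintegrable h ->
  cintegral (fun x => (h x)^*%C) = (cintegral h)^*%C.
Proof.
move=> [h1 h2]; rewrite /cintegral/=; congr Complex.
  by apply: eq_Rintegral => x _; case: (h x).
rewrite -mulN1r -RintegralZl//; apply: eq_Rintegral => x _.
by case: (h x) => a b /=; rewrite mulN1r.
Qed.

Lemma cintegral_ae h k : cmeasurable h -> cmeasurable k ->
  (\forall x \ae mu, h x = k x) -> cintegral h = cintegral k.
Proof.
move=> [h1 h2] [k1 k2] hk; rewrite /cintegral /Rintegral; congr Complex; congr fine;
  apply: ae_eq_integral => //; [exact/measurable_EFinP|exact/measurable_EFinP| |
    exact/measurable_EFinP|exact/measurable_EFinP|];
  by apply: filterS hk => x hx _; rewrite /= hx.
Qed.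

End complex_integral.

Section L2_space.
Context d (T : measurableType d) (R : realType).
Variable mu : {measure set T -> \bar R}.

Definition L2 := cLp mu (@lee1n R 2).

HB.instance Definition _ := NormedModule.on L2.
HB.instance Definition _ := EqQuotient.on L2.

Local Notation L2fun := (cLfunType mu (@lee1n R 2)).
Local Open Scope quotient_scope.

Definition L2_inner (u v : L2) : R[i] :=
  cintegral mu (fun x => repr u x * (repr v x)^*%C).

Lemma cmeasurable_inner (f g : L2fun) : cmeasurable (fun x => f x * (g x)^*%C).
Proof.
have /cLfunP[mf _] := cLfun_mem f; have /cLfunP[mg _] := cLfun_mem g.
exact: cmeasurableM mf (cmeasurable_conj mg).
Qed.

Lemma cintegrable_inner (f g : L2fun) :
  cintegrable mu (fun x => f x * (g x)^*%C).
Proof.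
have [m1 m2] := cmeasurable_inner f g.
have /cLfunP[mf nf] := cLfun_mem f; have /cLfunP[mg ng] := cLfun_mem g.
have lf : (fun x => cabs (f x)) \in Lfun mu 2%:E.
  by rewrite inE; apply/andP; split; rewrite inE//; exact: measurable_cabs.
have lg : (fun x => cabs (g x)) \in Lfun mu 2%:E.
  by rewrite inE; apply/andP; split; rewrite inE//; exact: measurable_cabs.
have /Lfun1_integrable ifg := Lfun2_mul_Lfun1 lf lg.
have le1 (z : R[i]) : `|complex.Re z| <= cabs z.
  by have := normc_ge_Re z; rewrite cabs_norm lecR.
have le2 (z : R[i]) : `|complex.Im z| <= cabs z.
  have := normc_ge_Re ('i%C * z); rewrite cabs_norm lecR Normc.normcM /=.
  by rewrite expr0n expr1n add0r sqrtr1 mul1r; case: z => a b /=;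
    rewrite mul0r mul1r add0r normrN.
have cM x : cabs (f x * (g x)^*%C) = cabs (f x) * cabs (g x).
  rewrite Normc.normcM; congr (_ * _).
  by case: (g x) => a b /=; rewrite sqrrN.
split; apply: (le_integrable measurableT _ _ ifg) => //;
  try exact/measurable_EFinP;
  move=> x _; rewrite /= lee_fin [leRHS]ger0_norm ?mulr_ge0 ?cabs_ge0// -cM;
  [exact: le1|exact: le2].
Qed.

Lemma L2_inner_pi (f g : L2fun) : L2_inner (\pi_L2 f) (\pi_L2 g) =
  cintegral mu (fun x => f x * (g x)^*%C).
Proof.
apply: cintegral_ae; [exact: cmeasurable_inner|exact: cmeasurable_inner|].
by apply: filterS2 (repr_cLp f) (repr_cLp g) => x fx gx; rewrite fx gx.
Qed.

Lemma L2_innerC (u v : L2) : L2_inner u v = (-1) ^+ false * (L2_inner v u)^*%C.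
Proof.
rewrite expr0 mul1r /L2_inner -cintegral_conj; last exact: cintegrable_inner.
congr cintegral; apply/funext => x; rewrite rmorphM/= conjcK mulrC.
by [].
Qed.

Lemma L2_innerDl (v u u' : L2) :
  L2_inner (u + u') v = L2_inner u v + L2_inner u' v.
Proof.
rewrite -[u]reprK -[u']reprK -[v]reprK.
move: (repr u) (repr u') (repr v) => f f' g.
rewrite -(pi_cLpD f f') !L2_inner_pi -cintegralD; try exact: cintegrable_inner.
by congr cintegral; apply/funext => x; rewrite -mulrDl.
Qed.

Lemma L2_innerZl (v : L2) (a : R[i]) (u : L2) :
  L2_inner (a *: u) v = a * L2_inner u v.
Proof.
rewrite -[u]reprK -[v]reprK; move: (repr u) (repr v) => f g.
rewrite -(pi_cLpZ a f : _ = a *: (_ : L2)) !L2_inner_pi.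
rewrite -cintegralZ; last exact: cintegrable_inner.
by congr cintegral; apply/funext => x; rewrite mulrA.
Qed.

Lemma L2_inner_zmod_morphisml v : zmod_morphism (L2_inner ^~ v).
Proof.
by move=> u u' /=; rewrite L2_innerDl -scaleN1r L2_innerZl mulN1r.
Qed.

Lemma L2_inner_zmod_morphismr u : zmod_morphism (L2_inner u).
Proof.
move=> v v'; rewrite !(L2_innerC u) !expr0 !mul1r L2_inner_zmod_morphisml.
by rewrite rmorphB.
Qed.

Lemma L2_inner_scalablel v : scalable_for *%R (L2_inner ^~ v).
Proof. by move=> a u /=; rewrite L2_innerZl. Qed.

Lemma L2_inner_scalabler u : scalable_for (@conjc R \; *%R) (L2_inner u).
Proof.
by move=> a v; rewrite !(L2_innerC u) !expr0 !mul1r L2_innerZl rmorphM.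
Qed.

HB.instance Definition _ := isBilinear.Build R[i] L2 L2 R[i] *%R
  (@conjc R \; *%R) L2_inner L2_inner_zmod_morphisml L2_inner_zmod_morphismr
  L2_inner_scalablel L2_inner_scalabler.

HB.instance Definition _ := isHermitianSesquilinear.Build R[i] L2 false
  (@conjc R) L2_inner L2_innerC.

Lemma L2_inner_norm (u : L2) : `|u| ^+ 2 = L2_inner u u.
Proof.
rewrite -[u]reprK; move: (repr u) => f; rewrite L2_inner_pi.
rewrite -[`|_|]/(cLp_norm _) cLp_norm_pi -rmorphXn/=.
have fE x : f x * (f x)^*%C = (cabs (f x) ^+ 2)%:C%C.
  by rewrite -sqr_normc cabs_norm rmorphXn.
rewrite /cintegral; under [X in Complex X _]eq_Rintegral do rewrite fE.
under [X in Complex _ X]eq_Rintegral do rewrite fE /=.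
rewrite [X in Complex _ X]Rintegral_cst// mul0r; congr _%:C%C.
apply: EFin_inj; rewrite /Rintegral -powR_mulrn ?fine_ge0 ?Lnorm_ge0//.
rewrite -poweR_EFin (fineK (cLnorm_fin_num f)) powR_Lnorm//=.
have i_ge0 : (0 <= \int[mu]_x (cabs (f x) ^+ 2)%:E)%E.
  by apply: integral_ge0 => x _; rewrite lee_fin sqr_ge0.
have iE : (\int[mu]_x `|(cabs (f x))%:E| `^ 2 =
    \int[mu]_x (cabs (f x) ^+ 2)%:E)%E.
  apply: eq_integral => x _.
  by rewrite gee0_abs ?lee_fin ?cabs_ge0// poweR_EFin powR_mulrn ?cabs_ge0.
rewrite iE fineK// ge0_fin_numE// -iE -(powR_Lnorm mu (EFin \o (fun x => cabs (f x))))//.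
have /cLfunP[_ nf] := cLfun_mem f.
exact: poweR_lty.
Qed.

Lemma L2_inner_gt0 (u : L2) : u != 0 -> 0 < L2_inner u u.
Proof. by move=> u0; rewrite -L2_inner_norm exprn_gt0// normr_gt0. Qed.

HB.instance Definition _ := isDotProduct.Build R[i] L2 L2_inner L2_inner_gt0.

HB.instance Definition _ := @isInnerProduct.Build R L2
  (L2_inner : {dot L2 for @conjc R}) L2_inner_norm.

End L2_space.

Section multiplication.
Context d (T : measurableType d) (R : realType).
Variable mu : {measure set T -> \bar R}.
Local Open Scope quotient_scope.

Definition Linfty := cLp mu (@leey R 1).

HB.instance Definition _ := NormedModule.on Linfty.
HB.instance Definition _ := EqQuotient.on Linfty.

Local Notation L2fun := (cLfunType mu (@lee1n R 2)).
Local Notation Linftyfun := (cLfunType mu (@leey R 1)).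

Lemma Linfty_bounded (f : Linftyfun) :
  exists2 M : R, 0 <= M & \forall x \ae mu, cabs (f x) <= M.
Proof.
exists (fine (cLnorm mu +oo f)); first by rewrite fine_ge0// Lnorm_ge0.
have := cLnorm_fin_num f; rewrite /cLnorm unlock /Lnorm.
case: ifPn => [mu0 ffin|]; last first.
  rewrite -leNgt => mu0 _; exists setT; split => //.
  by apply/eqP; rewrite eq_le mu0/=.
apply: filterS (ess_sup_ge mu (abse \o (EFin \o (fun x => cabs (f x))))) => x.
rewrite -lee_fin fineK//=; apply: le_trans.
by rewrite lee_fin ler_norm.
Qed.

Lemma mul_cLfun_subproof (f : Linftyfun) (g : L2fun) :
  (fun x => f x * g x) \in cLfun mu (@lee1n R 2).
Proof.
have /cLfunP[mf _] := cLfun_mem f; have /cLfunP[mg ng] := cLfun_mem g.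
have mfg := cmeasurableM mf mg.
apply/cLfunP; split => //.
have [M M0 fM] := Linfty_bounded f.
have mcg := measurable_cabs mg.
rewrite /cLnorm.
apply: (@le_lt_trans _ _
  (Lnorm mu 2%:R%:E (EFin \o (fun x => M * cabs (g x))))).
  apply: le_Lnorm_ae => //.
  - by rewrite (@lee1n R 2).
  - exact: measurable_cabs.
  - exact: measurable_funM.
  - by move=> x; exact: cabs_ge0.
  - by move=> x; rewrite mulr_ge0// cabs_ge0.
  by apply: filterS fM => x fxM; rewrite Normc.normcM ler_wpM2r// cabs_ge0.
rewrite LnormZ_ge0//; last by rewrite (@lee1n R 2).
by rewrite lte_mul_pinfty// lee_fin.
Qed.

Definition mul_cLfun f g : L2fun := CLfun (mul_cLfun_subproof f g).

Definition mulop (f : Linfty) (g : L2 mu) : L2 mu :=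
  \pi_(L2 mu) (mul_cLfun (repr f) (repr g)).

Lemma mulop_pi (f : Linftyfun) (g : L2fun) :
  mulop (\pi_Linfty f) (\pi_(L2 mu) g) = \pi_(L2 mu) (mul_cLfun f g).
Proof.
apply/eq_cLp; apply: filterS2 (repr_cLp f) (repr_cLp g) => x /= fx gx.
by rewrite fx gx.
Qed.

Lemma mulop_is_linear (f : Linfty) : linear (mulop f).
Proof.
move=> a u v; rewrite -[f]reprK -[u]reprK -[v]reprK.
move: (repr f) (repr u) (repr v) => {f u v} f u v.
have -> : a *: (\pi_(L2 mu) u : L2 mu) + \pi_(L2 mu) v = \pi_(L2 mu) (a *: u + v).
  by rewrite (pi_cLpD (a *: u) v) (pi_cLpZ a u).
rewrite !mulop_pi.
transitivity (\pi_(L2 mu) (a *: mul_cLfun f u + mul_cLfun f v)); last first.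
  by rewrite (pi_cLpD (a *: mul_cLfun f u)) (pi_cLpZ a (mul_cLfun f u)).
apply/eq_cLp; apply: nearW => x.
change (f x * (a * u x + v x) = a * (f x * u x) + f x * v x).
by rewrite mulrDr mulrCA.
Qed.

HB.instance Definition _ (f : Linfty) :=
  GRing.isLinear.Build R[i] (L2 mu) (L2 mu) *:%R (mulop f) (mulop_is_linear f).

(* mulop is the representation of L^oo on L^2 by multiplication; Sp is the
   preimage under mulop of the Schatten class. *)
Definition Sp (p : R) : set Linfty :=
  [set f | schatten_class p (mulop f : {linear L2 mu -> L2 mu})].

Definition atom (A : set T) :=
  [/\ measurable A, (0 < mu A)%E &
      forall B, measurable B -> B `<=` A -> mu B = 0%E \/ mu B = mu A].

Definition atomless := forall A, ~ atom A.

End multiplication.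

Arguments Sp {d T R} mu p _.

(* Main.v *)
Require Import Defs.
From mathcomp Require Import all_boot all_order all_algebra.
From mathcomp Require Import generic_quotient.
From mathcomp Require Import all_classical all_reals all_analysis.
From mathcomp Require Import measurable_realfun ess_sup_inf.
From mathcomp.real_closed Require Import complex.

(* A sigma-finite atom A has finite measure, and measurable functions are almost
   everywhere constant on A; hence multiplication by the indicator of A is the
   orthogonal projection onto a line, a nonzero element of every Schatten class.
   Conversely, if mu has no atom and f is not almost everywhere zero, some set
   {|f| >= eps} contains infinitely many disjoint sets of positive finite
   measure; their normalised indicators are orthonormal, and multiplication by
   f maps them to a sequence with mutual distances at least eps, so it is not
   even compact. *)

Set Implicit Arguments.
Unset Strict Implicit.
Unset Printing Implicit Defensive.

Import Order.TTheory GRing.Theory Num.Theory.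
Import numFieldNormedType.Exports.
Local Open Scope classical_set_scope.
Local Open Scope ring_scope.

(** * Sets of positive measure, with and without atoms *)

Section atoms.
Context d (T : measurableType d) (R : realType).
Variable mu : {measure set T -> \bar R}.
Implicit Types A B : set T.

(** Countably many sets of finite measure cover [A]; if each met [A] in a null set, [A] would be
    null. *)
Lemma sigma_finite_subset_fin A : sigma_finite setT mu ->
  measurable A -> (0 < mu A)%E ->
  exists B, [/\ measurable B, B `<=` A, (0 < mu B)%E & (mu B < +oo)%E].
Proof.
move=> [F TF mF] mA A0.
have [i Ai0] : exists i, mu (A `&` F i) != 0%E.
  apply: contrapT => /forallNP AF0.
  move: A0; rewrite -(setIT A) TF setI_bigcupr => /gt_eqF/eqP; apply.
  apply: measure_negligible.
    by apply: bigcupT_measurable => i; apply: measurableI => //; case: (mF i).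
  apply: negligible_bigcup => i; have [mFi _] := mF i.
  apply/negligibleP; first exact: measurableI.
  by apply/eqP/negPn/negP; exact: AF0.
have [mFi Fioo] := mF i.
exists (A `&` F i); split.
- exact: measurableI.
- exact: subIsetl.
- by rewrite lt0e Ai0 measure_ge0.
- apply: le_lt_trans Fioo; apply: le_measure; rewrite ?inE//.
  exact: measurableI.
Qed.

(** A subset of positive finite measure is not null, so it has the measure of the whole atom. *)
Lemma atom_fin A : sigma_finite setT mu -> atom mu A -> (mu A < +oo)%E.
Proof.
move=> muT [mA A0 atA].
have [B [mB BA B0 Boo]] := sigma_finite_subset_fin muT mA A0.
by have [B00|<-//] := atA B mB BA; rewrite B00 ltxx in B0.
Qed.

(** If for every measurable [B] inside [A] either [B] or its complement in [A] were null, then [A]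
    would be an atom. *)
Lemma atomless_split A : atomless mu ->
  measurable A -> (0 < mu A)%E -> (mu A < +oo)%E ->
  exists B, [/\ measurable B, B `<=` A, (0 < mu B)%E & (0 < mu (A `\` B))%E].
Proof.
move=> noatom mA A0 Aoo; apply: contrapT => /forallNP noB.
apply: (noatom A); split => // B mB BA.
have [->|B0] := eqVneq (mu B) 0%E; [by left|right].
have mAB : measurable (A `\` B) by exact: measurableD.
have [AB0|AB0] := eqVneq (mu (A `\` B)) 0%E.
  have -> : mu A = (mu (A `\` B) + mu (A `&` B))%E by exact: measureDI.
  by rewrite AB0 add0e setIidr.
by case: (noB B); rewrite !lt0e B0 AB0 !measure_ge0.
Qed.

(** Repeated splitting yields a decreasing sequence of sets that loses positive measure at each
    step; the successive differences are disjoint. *)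
Lemma atomless_disjoint_seq A : atomless mu ->
  measurable A -> (0 < mu A)%E -> (mu A < +oo)%E ->
  exists D : (set T)^nat, trivIset setT D /\
    forall n, [/\ measurable (D n), D n `<=` A & (0 < mu (D n))%E].
Proof.
move=> noatom mA A0 Aoo.
pose good B := [/\ measurable B, B `<=` A & (0 < mu B)%E].
have [next nextP] : {next : set T -> set T & forall B, good B ->
    [/\ good (next B), next B `<=` B & (0 < mu (B `\` next B))%E]}.
  apply: (@choice _ _ (fun B C => good B ->
    [/\ good C, C `<=` B & (0 < mu (B `\` C))%E])) => B.
  (* [choice] asks for a value at every set; where [B] is not good the requirement is vacuous and
     [set0] is a dummy. *)
  have [gB|ngB] := pselect (good B); last by exists set0.
  have [mB BA B0] := gB.
  have Boo : (mu B < +oo)%E.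
    by apply: le_lt_trans Aoo; apply: le_measure; rewrite ?inE.
  have [C [mC CB C0 BC0]] := atomless_split noatom mB B0 Boo.
  by exists C => _; split=> //; split=> //; exact: subset_trans BA.
pose C n := iter n next A.
have gC n : good (C n) by elim: n => [|n /nextP[]//]; split.
have CS m n : (m <= n)%N -> C n `<=` C m.
  move=> /subnK <-; elim: (n - m)%N => [//|k ih]; rewrite addSn.
  by apply: subset_trans ih; have [] := nextP _ (gC (k + m)%N).
exists (fun n => C n `\` C n.+1); split=> [|n].
  apply/trivIsetP => m n _ _.
  wlog mn : m n / (m < n)%N.
    move=> h; rewrite neq_ltn => /orP[mn|nm]; first by rewrite h// neq_ltn mn.
    by rewrite setIC h// neq_ltn nm.
  move=> _; apply/seteqP; split=> // x [[_ nCx] [Cx _]].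
  exact/nCx/(CS _ _ mn).
have [mC CA _] := gC n; have [mC' _ _] := gC n.+1; split.
- exact: measurableD.
- by move=> x [/CA].
- by have [] := nextP _ (gC n).
Qed.

(* The sets {g < q} with q rational are null or conull in A; discarding
   countably many null sets leaves a set on which no rational separates two
   values of g. *)
Lemma atom_ae_cst A (g : T -> R) : atom mu A -> (mu A < +oo)%E ->
  measurable_fun setT g -> exists c, \forall x \ae mu, A x -> g x = c.
Proof.
move=> [mA A0 atA] Aoo mg.
have mlt (q : R) : measurable (A `&` [set x | g x < q]).
  apply: measurableI => //; rewrite -[X in measurable X]setTI.
  rewrite (_ : [set x | _] = g @^-1` `]-oo, q[).
    exact: mg.
  by apply/seteqP; split=> x /=; rewrite in_itv.
(* Rationals are indexed by their codes in [nat], so that [ae_foralln] applies; for a number that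
   codes no rational the claim is vacuous and [true] is a dummy. *)
have dich (n : nat) : exists b : bool, \forall x \ae mu,
    forall q : rat, unpickle n = Some q -> A x -> (g x < ratr q) = b.
  case: (unpickle n) => [q|]; last by exists true; exact: nearW.
  have [gq0|gqA] := atA _ (mlt (ratr q)) (@subIsetl _ _ _).
    exists false; exists (A `&` [set x | g x < ratr q]); split => // x /= nx.
    apply: contrapT => nAx; apply: nx => _ [<-] Ax.
    by apply/negP => gxq; exact: nAx.
  exists true; exists (A `\` (A `&` [set x | g x < ratr q])); split => //.
  - exact: measurableD.
  - have -> : mu (A `\` (A `&` [set x | g x < ratr q])) =
      (mu A - mu (A `&` (A `&` [set x | (g x < ratr q)%R])))%E by exact: measureD.
    rewrite setIA setIid gqA subee//.
    by rewrite ge0_fin_numE.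
  move=> x /= nx; apply: contrapT => nAx; apply: nx => _ [<-] Ax.
  by apply: contrapT => ngxq; apply: nAx; split => // -[].
have [b bP] := choice dich.
have {bP} [N [mN N0 NP]] := ae_foralln bP.
(* Since [N] is null and [A] is not, a point of [A] outside [N] exists; the value of [g] there
   serves as the constant. *)
have [x0 [Ax0 Nx0]] : exists x, (A `\` N) x.
  apply/set0P/negP => /eqP AN0.
  move: A0.
  have -> : mu A = (mu (A `\` N) + mu (A `&` N))%E by exact: measureDI.
  rewrite AN0 measure0 add0e.
  have -> : mu (A `&` N) = 0%E by apply: subset_measure0 N0 => //; exact: measurableI.
  by rewrite ltxx.
have {}NP x : ~ N x -> forall q : rat, A x -> (g x < ratr q) = b (pickle q).
  move=> Nx q Ax.
  have gb : forall n q, unpickle n = Some q -> A x -> (g x < ratr q) = b n.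
    by apply: contrapT => /NP.
  by apply: gb => //; exact: pickleK.
exists (g x0); exists N; split => // x /= Agx; apply: contrapT => Nx; apply: Agx => Ax.
apply: contrapT => /eqP; rewrite neq_lt => /orP[] /rat_in_itvoo[q];
  rewrite in_itv/= => /andP[q1 q2].
  by move: q1; rewrite (NP x)// -(NP x0)// => /lt_trans/(_ q2); rewrite ltxx.
by move: q1; rewrite (NP x0)// -(NP x)// => /lt_trans/(_ q2); rewrite ltxx.
Qed.

End atoms.

(** * Indicator functions and their classes in L^2 and L^oo *)

Section indicators.
Context d (T : measurableType d) (R : realType).
Variable mu : {measure set T -> \bar R}.
Implicit Types A B : set T.
Local Open Scope quotient_scope.

Definition cindic A (x : T) : R[i] := (\1_A x)%:C%C.

Lemma cabs_cindic A x : cabs (cindic A x) = \1_A x.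
Proof. by rewrite /= expr0n addr0 sqrtr_sqr ger0_norm. Qed.

Lemma cmeasurable_cindic A : measurable A -> cmeasurable (cindic A).
Proof. by move=> mA; split; [exact: measurable_indic|exact: measurable_cst]. Qed.

(** An indicator is its own square, so the integral in its L^2 norm is [mu A]. *)
Lemma cindic_L2 A : measurable A -> (mu A < +oo)%E ->
  cindic A \in cLfun mu (@lee1n R 2).
Proof.
move=> mA Aoo; apply/cLfunP; split; first exact: cmeasurable_cindic.
rewrite /cLnorm unlock /Lnorm poweR_lty//.
rewrite (_ : (\int[mu]_x _)%E = mu A)//.
transitivity (\int[mu]_x (\1_A x)%:E)%E; last by rewrite integral_indic// setIT.
apply: eq_integral => x _; rewrite /comp cabs_cindic.
rewrite gee0_abs ?lee_fin// poweR_EFin indicE.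
by case: (x \in A); rewrite ?powR1 ?powR0.
Qed.

Lemma cindic_Linfty A : measurable A -> cindic A \in cLfun mu (@leey R 1).
Proof.
move=> mA; apply/cLfunP; split; first exact: cmeasurable_cindic.
rewrite /cLnorm unlock /Lnorm; case: ifP => // _.
apply: (@le_lt_trans _ _ 1%:E); last exact: ltry.
apply/ess_supP/nearW => x; rewrite /comp cabs_cindic /= lee_fin ger0_norm//.
Qed.

(** Both the separation of the images of an orthonormal sequence and the contractivity of
    multiplication by an indicator come from this pointwise criterion. *)
Lemma le_normL2 (f g : cLfunType mu (@lee1n R 2)) :
  (\forall x \ae mu, cabs (f x) <= cabs (g x)) ->
  `|\pi_(L2 mu) f| <= `|\pi_(L2 mu) g|.
Proof.
move=> fg; rewrite -[`|\pi_(L2 mu) f|]/(cLp_norm _) -[leRHS]/(cLp_norm _).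
rewrite !cLp_norm_pi lecR -lee_fin.
rewrite (fineK (cLnorm_fin_num f)) (fineK (cLnorm_fin_num g)).
have /cLfunP[mf _] := cLfun_mem f; have /cLfunP[mg _] := cLfun_mem g.
by apply: le_Lnorm_ae => //; do ?[exact: lee1n|exact: measurable_cabs|
  move=> x; exact: cabs_ge0].
Qed.

Lemma cindic_neq0 A (mA : measurable A) (Aoo : (mu A < +oo)%E) :
  (0 < mu A)%E -> \pi_(L2 mu) (CLfun (cindic_L2 mA Aoo)) != 0.
Proof.
move=> A0; apply/eqP => /esym; rewrite -[0](@pi_cLp0 _ _ _ mu) => /eq_cLp.
move=> [N [mN N0 NP]]; move: A0; rewrite (subset_measure0 mA mN _ N0) ?ltxx//.
move=> x Ax; apply: NP => /=; rewrite /cindic indicE mem_set// => /esym /eqP.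
by rewrite (_ : 1%:R%:C%C = 1)// oner_eq0.
Qed.

Lemma scale_piL2 (a : R[i]) (f : cLfunType mu (@lee1n R 2)) :
  a *: \pi_(L2 mu) f = \pi_(L2 mu) (a *: f).
Proof. by rewrite (pi_cLpZ a f). Qed.

Lemma sub_piL2 (f g : cLfunType mu (@lee1n R 2)) :
  \pi_(L2 mu) f - \pi_(L2 mu) g = \pi_(L2 mu) (f - g).
Proof.
rewrite -scaleN1r scale_piL2 -(pi_cLpD f (-1 *: g)).
by congr (\pi_(L2 mu) _); rewrite scaleN1r.
Qed.

End indicators.

(** * Compact multiplication operators over an atomless measure *)

Section compactness.
Context d (T : measurableType d) (R : realType).
Variable mu : {measure set T -> \bar R}.
Local Open Scope quotient_scope.

(** The sequence has a cluster point [v] in the compact closure, and infinitely many indices give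
    terms within [e / 2] of [v]. *)
Lemma precompact_not_separated (K : numFieldType) (V : normedModType K) (E : set V)
    (u : nat -> V) (e : K) : 0 < e -> precompact E -> (forall n, E (u n)) ->
  exists m n, (m < n)%N /\ `|u m - u n| < e.
Proof.
move=> e0; rewrite precompactE => cE Eu.
have [|v [_ clv]] := cE (u @ \oo) _.
  by exists 0%N => // n _; apply: subset_closure; exact: Eu.
have Bv : nbhs v (ball v (e / 2)) by apply: nbhsx_ballx; rewrite divr_gt0.
have near_v k : exists2 n, (k <= n)%N & `|v - u n| < e / 2.
  have [|_ [[n kn <-] vn]] := clv (u @` [set n | (k <= n)%N]) _ _ Bv.
    by exists k => // n kn; exists n.
  by exists n => //; move: vn; rewrite -ball_normE.
(* Starting the second search at [m.+1] makes the two indices distinct. *)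
have [m _ um] := near_v 0%N; have [n mn un] := near_v m.+1.
exists m, n; split => //.
rewrite -(subrKA v) (splitr e) (le_lt_trans (ler_normD _ _))// ltrD//.
by rewrite distrC.
Qed.

Lemma mulop_compact_eq0 (f : cLfunType mu (@leey R 1)) :
  sigma_finite setT mu -> atomless mu ->
  compact_operator (mulop (\pi_(Linfty mu) f) : {linear L2 mu -> L2 mu}) ->
  \pi_(Linfty mu) f = 0.
Proof.
move=> muT noatom cptf.
have /cLfunP[mf _] := cLfun_mem f.
rewrite -(@pi_cLp0 _ _ _ mu); apply/eq_cLp; apply: contrapT => f_neq0.
have mcf := measurable_cabs mf.
(* The sets [S k] exhaust the set where [f] is nonzero; if all were null, [f] would vanish almost
   everywhere. *)
pose S (k : nat) := [set x | k.+1%:R^-1 <= cabs (f x)].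
have mS k : measurable (S k).
  rewrite -[S k]setTI (_ : S k = (fun x => cabs (f x)) @^-1` `[k.+1%:R^-1, +oo[).
    exact: mcf.
  by apply/seteqP; split=> x; rewrite /S /= in_itv/= andbT.
have [k Sk0] : exists k, (0 < mu (S k))%E.
  apply: contrapT => /forallNP S0; apply: f_neq0.
  have : forall k, \forall x \ae mu, cabs (f x) < k.+1%:R^-1.
    move=> k; exists (S k); split => //.
      by apply/eqP; rewrite eq_le measure_ge0 andbT leNgt; exact/negP.
    by move=> x /= /negP; rewrite -leNgt.
  move=> /ae_foralln; apply: filterS => x fx; apply: Normc.eq0_normc; apply/eqP.
  rewrite eq_le cabs_ge0 andbT; apply/ler_addgt0Pl => e e0; rewrite addr0.
  have [n _ /(_ n (leqnn _))/= ne] := near_infty_natSinv_lt (PosNum e0).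
  exact: ltW (lt_trans (fx n) ne).
have [A [mA AS A0 Aoo]] := sigma_finite_subset_fin muT (mS k) Sk0.
have [D [tD DP]] := atomless_disjoint_seq noatom mA A0 Aoo.
have mD n : measurable (D n) by case: (DP n).
have Doo n : (mu (D n) < +oo)%E.
  by apply: le_lt_trans Aoo; apply: le_measure; rewrite ?inE//; case: (DP n).
pose g n := CLfun (cindic_L2 (mD n) (Doo n)).
have g0 n : \pi_(L2 mu) (g n) != 0 by apply: cindic_neq0; case: (DP n).
pose a n := `|\pi_(L2 mu) (g n)|^-1.
pose e n := \pi_(L2 mu) (a n *: g n).
have e1 n : `|e n| = 1.
  by rewrite /e -scale_piL2 normrZ normfV normr_id mulVf// normr_eq0.
pose eps : R[i] := (k.+1%:R^-1)%:C%C.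
have eps0 : 0 < eps by rewrite ltcR invr_gt0.
have [|m [n [mn]]] := @precompact_not_separated _ _ _
  (fun n => mulop (\pi_(Linfty mu) f) (e n)) eps eps0 cptf.
  by move=> n; exists (e n) => //=; rewrite e1.
suff le_eps : eps <= `|mulop (\pi_(Linfty mu) f) (e m) -
    mulop (\pi_(Linfty mu) f) (e n)|.
  by move=> /(le_lt_trans le_eps); rewrite ltxx.
(* As [e m] has norm 1, the bound becomes a comparison of L^2 norms, then a pointwise one: off [D m]
   the smaller side is 0, while on [D m] the indicator of [D n] vanishes and the modulus of [f] is
   at least [k.+1%:R^-1]. *)
have -> : eps = `|eps *: e m| by rewrite normrZ e1 mulr1 gtr0_norm.
have -> : mulop (\pi_(Linfty mu) f) (e m) - mulop (\pi_(Linfty mu) f) (e n) =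
    \pi_(L2 mu) (mul_cLfun f (a m *: g m - a n *: g n)).
  rewrite -(mulop_pi f (a m *: g m - a n *: g n)) -sub_piL2.
  exact/esym/(linearB (mulop (\pi_(Linfty mu) f) : {linear L2 mu -> L2 mu})).
rewrite /e scale_piL2; apply: le_normL2; apply: nearW => x.
have -> : (eps *: (a m *: g m)) x = eps * (a m * cindic R (D m) x) by [].
have -> : mul_cLfun f (a m *: g m - a n *: g n) x =
  f x * (a m * cindic R (D m) x - a n * cindic R (D n) x) by [].
have [xDm|xDm] := boolP (x \in D m); last first.
  rewrite [X in cabs X <= _](_ : _ = 0); first by rewrite Normc.normc0 cabs_ge0.
  by rewrite /cindic indicE (negbTE xDm) !mulr0.
have xDn : (x \in D n) = false.
  apply/negbTE/negP; rewrite inE => xDn.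
  have /trivIsetP/(_ m n I I) := tD; rewrite neq_ltn mn => /(_ isT) Dmn.
  by suff : (set0 : set T) x by []; rewrite -Dmn; split=> //; exact: set_mem.
rewrite [cindic R (D n) x]/cindic indicE xDn mulr0 subr0 !Normc.normcM.
rewrite ler_wpM2r ?mulr_ge0 ?cabs_ge0//.
have fx : k.+1%:R^-1 <= cabs (f x).
  by have [_ DA _] := DP m; apply: AS; apply: DA; exact: set_mem.
by rewrite [leLHS]/= expr0n addr0 sqrtr_sqr ger0_norm// invr_ge0.
Qed.

End compactness.

(** * Zero and rank one operators in the Schatten classes *)

Section schatten.
Context (R : realType).
(* R[i] inherits its topology as the carrier of a numFieldType; the head
   constant [complex] alone does not trigger the instances. *)
Let C : numFieldType := R[i].

Lemma continuous_realC : continuous (fun x : R => x%:C%C : C).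
Proof.
move=> x; apply/cvgrPdist_lt => eps; rewrite ltcE/= => /andP[/eqP Ieps Reps].
near=> y.
rewrite -rmorphB/= cabs_norm ltcE/= Ieps eqxx/= expr0n addr0 sqrtr_sqr.
near: y; exact: cvgr_dist_lt.
Unshelve. all: by end_near. Qed.

(** The continuous map sending (x, y) to (x + iy) e carries a compact square of R x R onto this set,
    so compactness comes from real segments. *)
Lemma compact_line (V : normedModType R[i]) (e : V) (M : R) :
  compact [set (z.1%:C + 'i * z.2%:C)%C *: e | z in `[- M, M] `*` `[- M, M]].
Proof.
apply: continuous_compact; last by apply: compact_setX; exact: segment_compact.
apply: continuous_subspaceT => z.
apply: (@continuousZr_tmp C V _
  (fun z : R * R => (z.1%:C + 'i * z.2%:C)%C : C) e z).
apply: cvgD.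
  apply: (@cvg_comp _ _ _ fst (fun x : R => x%:C%C : C)); first exact: cvg_fst.
  exact: continuous_realC.
apply: cvgMr.
apply: (@cvg_comp _ _ _ snd (fun x : R => x%:C%C : C)); first exact: cvg_snd.
exact: continuous_realC.
Qed.

(** The real and imaginary parts of [c] are bounded by its modulus, hence by [M] divided by the norm
    of [e], which puts the set inside the one of [compact_line]. *)
Lemma precompact_line (V : normedModType R[i]) (e : V) (M : R) : e != 0 ->
  precompact [set c *: e | c in [set c | `|c *: e| <= M%:C%C]].
Proof.
move=> e0.
have ne : 0 < `|e| by rewrite normr_gt0.
(* Norms take values in [R[i]]; [r] is the norm of [e] as an element of [R]. *)
pose r := complex.Re `|e|.
have er : `|e| = r%:C%C by rewrite RRe_real// gtr0_real.
have r0 : 0 < r by rewrite er ltcR in ne.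
apply: precompact_subset (compact_precompact (@norm_hausdorff C _)
  (@compact_line V e (M / r))).
move=> _ [c /= cM <-]; exists (complex.Re c, complex.Im c); last first.
  by rewrite /= -complexE.
move: cM; rewrite normrZ er cabs_norm -rmorphM/= lecR -ler_pdivlMr// => cM.
have Rc : `|complex.Re c| <= cabs c.
  by have := normc_ge_Re c; rewrite cabs_norm lecR.
have Ic : `|complex.Im c| <= cabs c.
  by case: (c) => x y /=; rewrite -sqrtr_sqr ler_wsqrtr// lerDr sqr_ge0.
by split; rewrite /= in_itv/= -ler_norml; [exact: le_trans Rc _|exact: le_trans Ic _].
Qed.

Lemma has_dim0 (H : innerProductType R) (V : set H) : V = [set 0] -> has_dim V 0.
Proof.
move=> ->; exists (fun=> 0) => x; split => [->|[c [-> _]]]; last by rewrite big_ord0.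
exists [ffun=> 0]; split => [|c _]; first by rewrite big_ord0.
by apply/ffunP => -[].
Qed.

Lemma has_dim1 (H : innerProductType R) (V : set H) (e : H) : e != 0 ->
  V = range (fun c : R[i] => c *: e) -> has_dim V 1.
Proof.
move=> e0 ->; exists (fun=> e) => x; split => [[c _ <-]|[c [-> _]]]; last first.
  by rewrite big_ord1; exists (c ord0).
exists [ffun=> c]; split => [|c']; first by rewrite big_ord1 ffunE.
rewrite big_ord1 => /eqP; rewrite -subr_eq0 -scalerBl scaler_eq0 (negbTE e0) orbF.
by rewrite subr_eq0 => /eqP cc'; apply/ffunP => i; rewrite ffunE cc' (ord1 i).
Qed.

(** All singular values are 0: for t > 0 the eigenspace of T^* T for t^2 is trivial, and t never
    occurs in the zero sequence. *)
Lemma schatten_class0 (H : innerProductType R) (T : {linear H -> H}) (p : R) :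
  1 <= p -> (forall x, T x = 0) -> schatten_class p T.
Proof.
move=> p1 T0; have p0 : 0 < p by rewrite (lt_le_trans ltr01).
split.
- by exists 0 => x; rewrite T0 normr0 mul0r.
- apply: (@precompact_subset _ _ [set 0]); first by move=> _ [x _ <-]; rewrite T0.
  by apply: compact_precompact; [exact: norm_hausdorff|exact: compact_set1].
exists (fun=> 0); last first.
  rewrite Lnorm_counting// eseries0 ?poweR_lty ?ltry// => i _ _.
  by rewrite /comp abse0 poweR0r// gt_eqF.
split => //; exists T => [x y|t t0]; first by rewrite !T0 linear0l linear0r.
exists 0%N.
  apply: has_dim0; apply/seteqP; split => x; rewrite /Defs.eigenspace /= !T0.
    move=> /esym/eqP; rewrite scaler_eq0 => /orP[|/eqP//].
    by rewrite eq_complex/= eqxx andbT sqrf_eq0 gt_eqF.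
  by move=> ->; rewrite scaler0.
rewrite (_ : [set _ | _] = set0) ?II0; first exact: card_eqxx.
by apply/seteqP; split=> // n /= t00; rewrite t00 ltxx in t0.
Qed.

(** The hypotheses make [T] a self-adjoint idempotent with range the line of [e]. Thus T^* T = T,
    its only nonzero eigenvalue is 1, with that line as eigenspace, and the singular values are 1,
    0, 0, ... *)
Lemma schatten_class_rank1 (H : innerProductType R) (T : {linear H -> H}) (e : H)
    (p : R) : 1 <= p -> e != 0 -> adjoint_of T T ->
  (forall x, `|T x| <= `|x|) -> T e = e -> (forall x, exists c, T x = c *: e) ->
  schatten_class p T.
Proof.
move=> p1 e0 Tadj Tle Te Tline; have p0 : 0 < p by rewrite (lt_le_trans ltr01).
have TT x : T (T x) = T x by have [c ->] := Tline x; rewrite linearZ/= Te.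
split.
- by exists 1 => x; rewrite mul1r.
- apply: (precompact_subset _ (@precompact_line H e 1 e0)) => _ [x /= x1 <-].
  have [c Tx] := Tline x; exists c => //=.
  by rewrite -Tx (le_trans (Tle x)).
exists (fun n => (n == 0)%:R); last first.
  rewrite Lnorm_counting// poweR_lty//.
  rewrite (nneseries_split 0 1)//; last by move=> k _; exact: poweR_ge0.
  rewrite big_nat1 eseries0; last first.
    by move=> [|i]// _ _; rewrite /comp abse0 poweR0r// gt_eqF.
  by rewrite adde0 poweR_lty// ltry.
split.
- move=> m n; case: n => [|n]; first by rewrite leqn0 => /eqP ->.
  by rewrite ler0n.
- by move=> n; rewrite ler0n.
exists T => // t t0; have [t1|t1] := eqVneq t 1.
  exists 1%N.
    apply: (has_dim1 e0); apply/seteqP; split => x;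
      rewrite /Defs.eigenspace /= TT t1 expr1n scale1r.
      by move=> <-; have [c ->] := Tline x; exists c.
    by move=> [c _ <-]; rewrite linearZ/= Te.
  rewrite (_ : [set _ | _] = [set 0%N]); first exact: card_set1.
  rewrite t1; apply/seteqP; split => [[|n]//= /eqP|_ ->//].
  by rewrite eq_sym oner_eq0.
exists 0%N.
  apply: has_dim0; apply/seteqP; split => x; rewrite /Defs.eigenspace /=; last first.
    by move=> ->; rewrite !linear0.
  rewrite TT => Tx.
  have t2 : (t ^+ 2)%:C%C != 0 :> R[i].
    by rewrite eq_complex/= eqxx andbT sqrf_eq0 gt_eqF.
  (* Applying [T] to T x = t^2 x gives T x = t^2 T x, where t^2 differs from 1. *)
  have Tx0 : T x = 0.
    have := congr1 T Tx; rewrite TT linearZ/= => /eqP.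
    rewrite -subr_eq0 -{1}[T x]scale1r -scalerBl scaler_eq0 subr_eq0 => /orP[|/eqP//].
    by rewrite eq_sym eq_complex/= eqxx andbT sqrp_eq1 ?ltW// (negbTE t1).
  move: Tx; rewrite Tx0 => /esym/eqP.
  by rewrite scaler_eq0 (negbTE t2) => /eqP.
rewrite (_ : [set _ | _] = set0) ?II0; first exact: card_eqxx.
apply/seteqP; split=> // -[|n] /= tn; first by rewrite -tn eqxx in t1.
by rewrite -tn ltxx in t0.
Qed.

End schatten.

(** * Multiplication by the indicator of an atom, and the equivalence *)

Section multiplication_by_atom.
Context d (T : measurableType d) (R : realType).
Variable mu : {measure set T -> \bar R}.
Local Open Scope quotient_scope.

(** The indicator is real, idempotent and at most 1, which gives self-adjointness and contractivity;
    the range is a line because functions are almost everywhere constant on an atom. *)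
Lemma schatten_class_atom (A : set T) (p : R) (mA : measurable A) : 1 <= p ->
  atom mu A -> (mu A < +oo)%E ->
  schatten_class p (mulop (\pi_(Linfty mu) (CLfun (cindic_Linfty mu mA)))
    : {linear L2 mu -> L2 mu}).
Proof.
move=> p1 atA Aoo; have [_ A0 _] := atA.
set f := CLfun _; set M := mulop _ : {linear L2 mu -> L2 mu}.
set e := CLfun (cindic_L2 mA Aoo).
have fI x : f x = f x * f x.
  by rewrite /= /cindic -rmorphM/= indicE; case: (x \in A); rewrite ?mulr1 ?mulr0.
have ME u : M (\pi_(L2 mu) u) = \pi_(L2 mu) (mul_cLfun f u) by exact: mulop_pi.
apply: (schatten_class_rank1 p1 (cindic_neq0 mA Aoo A0)).
- move=> u v; rewrite -[u]reprK -[v]reprK; move: (repr u) (repr v) => {u v} u v.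
  rewrite !ME -![inner _ _]/(L2_inner _ _) !L2_inner_pi.
  congr cintegral; apply/funext => x.
  rewrite -[mul_cLfun f u x]/(f x * u x) -[mul_cLfun f v x]/(f x * v x).
  rewrite rmorphM mulrCA mulrA; congr (_ * _).
  by congr (_ * _); apply/eqP; rewrite eq_complex /= oppr0 !eqxx.
- move=> u; rewrite -[u]reprK; move: (repr u) => {}u.
  rewrite ME; apply: le_normL2; apply: nearW => x.
  rewrite -[mul_cLfun f u x]/(f x * u x) Normc.normcM cabs_cindic indicE.
  by rewrite ler_piMl ?cabs_ge0//; case: (x \in A).
- rewrite ME; apply/eq_cLp; apply: nearW => x.
  by rewrite -[RHS]/(f x) fI.
move=> u; rewrite -[u]reprK; move: (repr u) => {}u.
have /cLfunP[[mRe mIm] _] := cLfun_mem u.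
(* The coefficient on the line is the almost everywhere constant value a + ib of [u] on [A]. *)
have [a ga] := atom_ae_cst atA Aoo mRe.
have [b gb] := atom_ae_cst atA Aoo mIm.
exists (Complex a b); rewrite ME scale_piL2; apply/eq_cLp.
apply: filterS2 ga gb => x; rewrite -[mul_cLfun f u x]/(cindic R A x * u x).
rewrite -[(_ *: e) x]/(Complex a b * cindic R A x) /cindic indicE.
have [xA|_ _ _] := boolP (x \in A); last by rewrite mulr0 mul0r.
move=> /(_ (set_mem xA)) ga /(_ (set_mem xA)) gb.
by rewrite mulrC -ga -gb; case: (u x).
Qed.

Lemma Sp_eq0_iff_atomless (p : R) : sigma_finite setT mu -> 1 <= p ->
  Sp mu p = [set 0] <-> atomless mu.
Proof.
move=> muT p1; split=> [Sp0 A atA|noatom].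
  have [mA A0 _] := atA; have Aoo := atom_fin muT atA.
  have : Sp mu p (\pi_(Linfty mu) (CLfun (cindic_Linfty mu mA))).
    exact: schatten_class_atom.
  (* Classes in L^oo and in L^2 are both taken modulo equality almost everywhere, so an indicator
     that vanishes in L^oo also vanishes in L^2, against [cindic_neq0]. *)
  rewrite Sp0 /= -[0](@pi_cLp0 _ _ _ mu) => /eq_cLp f0.
  move: (cindic_neq0 mA Aoo A0) => /eqP; apply.
  by rewrite -[0](@pi_cLp0 _ _ _ mu); apply/eq_cLp.
apply/seteqP; split => f /=.
  move=> [_ cptf _]; rewrite -[f]reprK; apply: mulop_compact_eq0 => //.
  by rewrite reprK.
move=> ->; apply: schatten_class0 => // u.
transitivity (mulop (\pi_(Linfty mu) 0) (\pi_(L2 mu) (repr u))).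
  by rewrite reprK (@pi_cLp0 _ _ _ mu).
rewrite mulop_pi -[RHS](@pi_cLp0 _ _ _ mu); apply/eq_cLp; apply: nearW => x.
exact: mul0r.
Qed.

End multiplication_by_atom.

Theorem theorem1 (R : realType) (X : ptopologicalType)
    (mu : {measure set (g_sigma_algebraType (@open X)) -> \bar R})
    (mu_sigma_finite : sigma_finite [set: g_sigma_algebraType (@open X)] mu)
    (p : R) (p_ge1 : 1 <= p) :
  Sp mu p = [set 0] <-> atomless mu.
Proof. exact: Sp_eq0_iff_atomless. Qed.
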